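(* Suppose $\Omega$ is a Lebesgue measurable set which tiles $\mathbb{R}$ with a subset $B$ of $\mathbb{Z}$ which has the following properties: the cardinality $|B|=p$ is a prime number, $0\in B$, and $\gcd(B)=1$. Then $B$ is a complete set of representatives modulo $p$, and $\Omega$ has period $p$.
   Context: A measurable set $\Omega\subseteq\mathbb{R}$ *tiles* $\mathbb{R}$ with a set $B\subset\mathbb{R}$ if the translates $\Omega+b$, $b\in B$, form a partition of $\mathbb{R}$ up to Lebesgue measure zero. $\gcd(B)$ is the greatest common divisor of the elements of $B$. $B\subseteq\mathbb{Z}$ is a *complete set of representatives modulo $p$* if for every $k\in\mathbb{Z}$ there is a unique $b\in B$ with $k-b\in p\mathbb{Z}$. $\Omega$ *has period* $p$ if $\Omega+p=\Omega$ up to Lebesgue measure zero. *)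

(* Defs.v *)
From mathcomp Require Import all_boot all_order all_algebra finmap.
From mathcomp Require Import all_classical all_reals all_analysis.

Set Implicit Arguments.
Unset Strict Implicit.
Unset Printing Implicit Defensive.

Import Order.TTheory GRing.Theory Num.Theory.
Import numFieldNormedType.Exports.

Local Open Scope classical_set_scope.
Local Open Scope ring_scope.

(* In the library, [measurable] on R means Borel. The Lebesgue measurable sets
   are the Caratheodory measurable sets of the Lebesgue outer measure; they
   form the domain of [completed_lebesgue_measure], and by
   [completed_caratheodory_measurable] they are the unions of a Borel set and
   a Lebesgue negligible set. *)
Definition Lebesgue_measurable (R : realType) (E : set R) : Prop :=
  ((@wlength R idfun)^*)%mu.-cara.-measurable E.

(* The library's [negligible] means: contained in a Borel set of measure 0. *)
Definition Lebesgue_null (R : realType) (N : set R) : Prop :=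
  (@lebesgue_measure R).-negligible N.

(* [`+`] is the symmetric difference. *)
Definition eq_up_to_null (R : realType) (E F : set R) : Prop :=
  Lebesgue_null (E `+` F).

Definition translate (R : realType) (E : set R) (t : R) : set R :=
  [set x + t | x in E].

Definition tiles (R : realType) (E B : set R) : Prop :=
  (forall b c, B b -> B c -> b <> c ->
     Lebesgue_null (translate E b `&` translate E c)) /\
  eq_up_to_null (\bigcup_(b in B) translate E b) setT.

Definition has_period (R : realType) (E : set R) (t : R) : Prop :=
  eq_up_to_null (translate E t) E.

Definition gcd_fset (B : {fset int}) : int := \big[gcdz/0]_(b <- B) b.

Definition complete_representatives (B : {fset int}) (p : nat) : Prop :=
  forall k : int, exists! b : int, b \in B /\ (p %| k - b)%Z.

Definition int_points (R : realType) (B : {fset int}) : set R :=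
  [set b%:~R | b in [set` B]].
Arguments int_points R B : clear implicits.

(* Main.v *)
Require Import Defs.
From mathcomp Require Import all_boot all_order all_algebra finmap.
From mathcomp Require Import all_classical all_reals all_analysis.
From mathcomp Require Import zify ring.

(** Write [f n] for the truth of [x + n \in Omega], where [x] is a fixed real
    number and [n] runs over the integers.  The tiling property fails only on a
    null set, and since countable unions and translates of null sets are null,
    the set of those [x] for which it fails at some [x + n] is null as well.
    For every other [x], [f] is the indicator of a set of integers that tiles
    exactly: each integer [n] has one [b] in [B] with [f (n - b)]
    ([tiles_fibre]).  This reduces the theorem to tilings of the integers.

    Let [T] be the shift operator, [(T g) n = g (n - 1)].  The tiling says
    [B(T) f = 1] with [B(T) = \sum_(b in B) T^b].  Modulo the prime [p] the
    Frobenius identity gives [B(T^p) = B(T)^p], and [B(T)^p f = p^(p-1) = 0]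
    because [B(T)] multiplies constants by [#|B| = p] ([sum_dilate]).  So the
    sum of the [p] numbers [f (n - p b)], each [0] or [1], is divisible by
    [p]: they are all equal, and equal to [f n] because [0] is in [B]
    ([tiles_int_dilate]).  Hence every [p b] is a period of [f]; periods form a
    group and the elements of [B] have gcd [1], so [p] is a period
    ([tiles_int_periodic]).

    Finally a tile with period [p] cannot have two elements of [B] in one class
    modulo [p], since its translates by them would coincide; as [B] has [p]
    elements, it meets each class exactly once ([tiles_int_complete]).  Reading
    the periodicity of [f] at almost every [x] gives the periodicity of
    [Omega]. *)

Set Implicit Arguments.
Unset Strict Implicit.
Unset Printing Implicit Defensive.

Import Order.TTheory GRing.Theory Num.Theory.

Local Open Scope fset_scope.
Local Open Scope classical_set_scope.
Local Open Scope ring_scope.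

(** * Sums over a dilated set modulo a prime *)

(** The value at [n] of [P(T) g], with [T] the shift [(T g) n = g (n - 1)]:
    the commutative ring [{poly F}] stands for the ring of shift operators, so
    that Frobenius applies there. *)
Definition poly_shift (F : comNzRingType) (g : int -> F) (n : int)
    (P : {poly F}) : F :=
  \sum_(i < size P) P`_i * g (n - i%:Z).

Lemma poly_shift_widen (F : comNzRingType) (g : int -> F) n (P : {poly F}) m :
  (size P <= m)%N -> poly_shift g n P = \sum_(i < m) P`_i * g (n - i%:Z).
Proof.
move=> Pm; rewrite /poly_shift (big_ord_widen _ (fun i => P`_i * g (n - i%:Z)) Pm).
rewrite big_mkcond; apply: eq_bigr => i _; case: ltnP => // Pi.
by rewrite nth_default ?mul0r.
Qed.

Lemma poly_shift0 (F : comNzRingType) (g : int -> F) n : poly_shift g n 0 = 0.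
Proof. by rewrite /poly_shift size_poly0 big_ord0. Qed.

Lemma poly_shiftD (F : comNzRingType) (g : int -> F) n (P Q : {poly F}) :
  poly_shift g n (P + Q) = poly_shift g n P + poly_shift g n Q.
Proof.
pose m := maxn (size P) (size Q).
rewrite !(@poly_shift_widen _ _ _ _ m) ?leq_maxl ?leq_maxr ?size_polyD//.
by rewrite -big_split; apply: eq_bigr => i _; rewrite coefD mulrDl.
Qed.

Lemma poly_shiftXnM (F : comNzRingType) (g : int -> F) n b (P : {poly F}) :
  poly_shift g n ('X^b * P) = poly_shift g (n - b%:Z) P.
Proof.
rewrite (@poly_shift_widen _ _ _ _ (b + size P)); last first.
  by rewrite (leq_trans (size_polyMleq _ _))// size_polyXn.
rewrite big_split_ord/= big1 ?add0r => [|i _]; last first.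
  by rewrite coefXnM ltn_ord mul0r.
apply: eq_bigr => i _; rewrite coefXnM ltnNge leq_addr/= addKn.
by rewrite PoszD opprD addrA.
Qed.

Lemma poly_shiftXn (F : comNzRingType) (g : int -> F) n b :
  poly_shift g n 'X^b = g (n - b%:Z).
Proof.
by rewrite -['X^b]mulr1 poly_shiftXnM /poly_shift size_poly1 big_ord1 coef1/=
  mul1r subr0.
Qed.

(** [(S P)(T) = S(T) P(T)] for [S] a sum of monomials; applying the factors one
    at a time is what allows the evaluation of powers of [S(T)]. *)
Lemma poly_shift_sumM (F : comNzRingType) (g : int -> F) n (s : seq nat)
    (e : nat -> nat) (P : {poly F}) :
  poly_shift g n ((\sum_(b <- s) 'X^(e b)) * P) =
  \sum_(b <- s) poly_shift g (n - (e b)%:Z) P.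
Proof.
elim: s => [|b s IHs]; first by rewrite !big_nil mul0r poly_shift0.
by rewrite !big_cons mulrDl poly_shiftD poly_shiftXnM IHs.
Qed.

(** With [Q = \sum_b 'X^b], [Q(T)] sends [g] to the constant [c], and then to
    [size s * c = 0].  So [Q(T)^p g] vanishes, while [Q^p = \sum_b 'X^(p * b)]
    in characteristic [p]. *)
Lemma sum_dilate_nat (F : comNzRingType) p (g : int -> F) (c : F)
    (s : seq nat) :
  p \in [pchar F] -> size s = p ->
  (forall n : int, \sum_(b <- s) g (n - b%:Z) = c) ->
  forall n : int, \sum_(b <- s) g (n - (p * b)%:Z) = 0.
Proof.
move=> pF sp gc n.
have p1 : (1 < p)%N by rewrite prime_gt1// (pcharf_prime pF).
pose Q : {poly F} := \sum_(b <- s) 'X^b.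
have Q1 m : poly_shift g m Q = c.
  rewrite -[Q]mulr1 poly_shift_sumM -[RHS](gc m); apply: eq_bigr => b _.
  by rewrite -[1]/('X^0) poly_shiftXn subr0.
(* [Q(T)] multiplies constants by [p = 0], so two factors already suffice. *)
have Q2 k m : poly_shift g m (Q ^+ k.+2) = 0.
  elim: k m => [|k IHk] m; rewrite exprS poly_shift_sumM; last by rewrite big1.
  under eq_bigr do rewrite expr1 Q1.
  by rewrite big_const_seq count_predT sp iter_addr addr0 mulrn_pchar.
have pFX : p \in [pchar {poly F}] by rewrite pchar_poly.
have pE : p.-2.+2 = p by lia.
have Qp : Q ^+ p = \sum_(b <- s) 'X^(p * b).
  rewrite -(pFrobenius_autE pFX) rmorph_sum/=.
  by apply: eq_bigr => b _; rewrite pFrobenius_autE mulnC exprM.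
rewrite -[RHS](Q2 p.-2 n) pE Qp -[X in poly_shift _ _ X]mulr1 poly_shift_sumM.
apply: eq_bigr => b _.
by rewrite -[1]/('X^0) poly_shiftXn subr0.
Qed.

Lemma seq_int_lbound (s : seq int) : exists m : int, {in s, forall b, m <= b}.
Proof.
elim: s => [|a s [m ms]]; first by exists 0.
exists (Num.min a m) => b; rewrite inE => /predU1P[->|/ms mb].
  by rewrite ge_min lexx.
by rewrite ge_min mb orbT.
Qed.

(** Translating [s] by a lower bound [m] only translates the sums, which reduces
    to nonnegative exponents. *)
Lemma sum_dilate (F : comNzRingType) p (g : int -> F) (c : F) (s : seq int) :
  p \in [pchar F] -> size s = p ->
  (forall n : int, \sum_(b <- s) g (n - b) = c) ->
  forall n : int, \sum_(b <- s) g (n - p%:Z * b) = 0.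
Proof.
move=> pF sp gc n; have [m ms] := seq_int_lbound s.
pose t := [seq `|b - m|%N | b <- s].
have tE b : b \in s -> (`|b - m|%N)%:Z = b - m.
  by move=> /ms mb; rewrite gez0_abs ?subr_ge0.
have tp : size t = p by rewrite size_map.
have tc k : \sum_(b <- t) g (k - b%:Z) = c.
  rewrite big_map -[RHS](gc (k + m)) big_seq [RHS]big_seq.
  by apply: eq_bigr => b /tE->; congr g; ring.
rewrite -[RHS](sum_dilate_nat pF tp tc (n - p%:Z * m)) big_map.
rewrite big_seq [RHS]big_seq.
by apply: eq_bigr => b /tE tEb; congr g; rewrite PoszM tEb; ring.
Qed.

Lemma all_or_none_of_dvdn_sum (T : eqType) (a : pred T) (s : seq T) :
  (size s %| \sum_(x <- s) a x)%N -> {in s &, forall x y, a x = a y}.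
Proof.
have -> : (\sum_(x <- s) a x)%N = count a s.
  by elim: s => [|x s IHs]; rewrite ?big_nil ?big_cons ?IHs.
move=> /dvdnP[[|k] ks] x y xs ys.
  have : ~~ has a s by rewrite has_count ks.
  by move/hasPn => sN; rewrite (negbTE (sN _ xs)) (negbTE (sN _ ys)).
have /allP sa : all a s.
  by rewrite all_count eqn_leq count_size ks mulSn leq_addr.
by rewrite !sa.
Qed.

(** * Tilings of the integers *)

Lemma gcdz_seq_closed (P : int -> Prop) (s : seq int) :
  P 0 -> (forall x y, P x -> P y -> P (x - y)) ->
  {in s, forall b, P b} -> P (\big[gcdz/0]_(b <- s) b).
Proof.
move=> P0 PB.
have PN x : P x -> P (- x) by rewrite -sub0r; exact: PB.
have PD x y : P x -> P y -> P (x + y).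
  by move=> Px /PN Py; rewrite -[y]opprK; exact: PB.
have PM (u x : int) : P x -> P (u * x).
  move=> Px; have PMn (k : nat) : P (k%:Z * x).
    elim: k => [|k IHk]; first by rewrite mul0r.
    by rewrite intS mulrDl mul1r; exact: PD.
  by case: u => k //; rewrite NegzE mulNr; exact/PN/PMn.
move=> Ps; rewrite big_seq; apply: big_ind => // x y Px Py.
by have [u [v <-]] := Bezoutz x y; apply: PD; exact: PM.
Qed.

Definition tiles_int (f : pred int) (B : {fset int}) : Prop :=
  forall n : int, exists! b : int, b \in B /\ f (n - b).

(** The number of [b] with [f (n - b)], counted in a ring so that it can be
    reduced modulo [p]. *)
Lemma tiles_int_sum (F : comNzRingType) (f : pred int) (B : {fset int}) :
  tiles_int f B -> forall n : int, \sum_(b <- B) (f (n - b))%:R = 1 :> F.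
Proof.
move=> fB n; have [b [[bB fb] bU]] := fB n.
rewrite (bigD1_seq b)//=; last by exact: fset_uniq.
rewrite fb big_seq_cond big1 ?addr0// => c /andP[cB cb].
by case: (boolP (f (n - c))) => // fc; rewrite (bU c (conj cB fc)) eqxx in cb.
Qed.

(** The [p] values [f (n - p * b)] are [0] or [1] with sum divisible by [p]
    ([sum_dilate]), hence equal; the one at [b = 0] is [f n]. *)
Lemma tiles_int_dilate (f : pred int) (B : {fset int}) (p : nat) :
  prime p -> #|` B| = p -> 0 \in B -> tiles_int f B ->
  {in B, forall b n, f (n - p%:Z * b) = f n}.
Proof.
move=> p_prime cardB B0 fB b bB n.
have pF := pchar_Fp p_prime.
have /(_ n) := sum_dilate (g := fun m => (f m)%:R) pF cardB
  (tiles_int_sum 'F_p fB).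
rewrite -natr_sum => /eqP; rewrite -(dvdn_pcharf pF) -{1}cardB => /all_or_none_of_dvdn_sum nB.
by rewrite (nB b 0 bB B0) mulr0 subr0.
Qed.

(** The [d] such that [p * d] is a period form a subgroup of the integers which
    contains [B], hence its gcd. *)
Lemma tiles_int_periodic (f : pred int) (B : {fset int}) (p : nat) :
  prime p -> #|` B| = p -> 0 \in B -> gcd_fset B = 1 -> tiles_int f B ->
  forall n : int, f (n + p%:Z) = f n.
Proof.
move=> p_prime cardB B0 gcdB fB.
have fpB := tiles_int_dilate p_prime cardB B0 fB.
suff fp n : f (n - p%:Z * 1) = f n by move=> n; rewrite -[LHS]fp mulr1 addrK.
rewrite -gcdB /gcd_fset; move: n.
apply: (@gcdz_seq_closed (fun d => forall n : int, f (n - p%:Z * d) = f n)) => //.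
  by move=> n; rewrite mulr0 subr0.
move=> x y fx fy n.
by rewrite -[RHS]fx -[LHS]fy; congr f; ring.
Qed.

(** If [b = c] modulo [p] and [f n0], then [n0 + b] lies in both translates of
    the tile, by [b] and by [c]; so [B] injects into the [p] residues, and the
    injection is onto by cardinality. *)
Lemma tiles_int_complete (f : pred int) (B : {fset int}) (p : nat) :
  (0 < p)%N -> #|` B| = p -> tiles_int f B -> (forall n, f (n + p%:Z) = f n) ->
  complete_representatives B p.
Proof.
move=> p0 cardB fB fp.
have fpM (k : int) n : f (n + k * p%:Z) = f n.
  have fpn (i : nat) m : f (m + i%:Z * p%:Z) = f m.
    elim: i => [|i IHi]; first by rewrite mul0r addr0.
    by rewrite intS mulrDl mul1r addrCA addrC fp IHi.
  case: k => i; first exact: fpn.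
  by rewrite -[LHS](fpn i.+1) NegzE; congr f; ring.
have [n0 fn0] : exists n0, f n0.
  by have [b [[_ fb] _]] := fB 0; exists (0 - b).
have Binj : {in B &, forall b c, (p %| b - c)%Z -> b = c}.
  move=> b c bB cB /dvdzP[q bc]; have [d [_ dU]] := fB (n0 + b).
  have db : d = b by apply: dU; rewrite addrK.
  by rewrite -db; apply: dU; rewrite -addrA bc fpM.
have pz : p%:Z != 0 by lia.
pose res (b : int) := `|(b %% p%:Z)%Z|%N.
have resE b : (res b)%:Z = (b %% p%:Z)%Z by rewrite gez0_abs// modz_ge0.
have resP b c : res b = res c -> (p %| b - c)%Z.
  by move=> bc; rewrite -eqz_mod_dvd -!resE bc.
have resU : uniq (map res B).
  rewrite map_inj_in_uniq ?fset_uniq// => b c bB cB /resP; exact: Binj.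
have resI : {subset map res B <= iota 0 p}.
  move=> _ /mapP[b _ ->]; rewrite mem_iota/= add0n.
  by have := ltz_pmod b (_ : 0 < p%:Z); rewrite -resE; lia.
have resS : (size (iota 0 p) <= size (map res B))%N.
  by rewrite size_iota size_map cardB.
have [_ resB] := uniq_min_size resU resI resS.
move=> k.
have : res k \in map res B.
  rewrite resB mem_iota/= add0n.
  by have := ltz_pmod k (_ : 0 < p%:Z); rewrite -resE; lia.
move=> /mapP[b bB /resP kb]; exists b; split=> // c [cB kc].
apply: Binj => //; rewrite (_ : b - c = (k - c) - (k - b)); last by ring.
by rewrite rpredB.
Qed.

(** * Null sets of the line *)

Lemma lebesgue_measure_shift (R : realType) (t : R) (A : set R) :
  measurable A ->
  pushforward lebesgue_measure
    ((fun x => x + t) : _ -> measurableTypeR R) A = lebesgue_measure A.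
Proof.
move=> mA; apply/esym/lebesgue_measure_unique => //=.
  exact: measurable_realfun.measurable_funD.
move=> mt _ [[a b]] _ <-; rewrite /pushforward.
have -> : (fun x => x + t) @^-1` `]a, b] = `]a - t, b - t]%classic.
  by apply/seteqP; split=> x /=; rewrite !in_itv/= ltrBlDr lerBrDr.
rewrite !lebesgue_measure_itv/= !lte_fin ltrD2r.
by case: ifP => // _; rewrite -!EFinB opprB addrA subrK.
Qed.

Lemma lebesgue_null_preimage_shift (R : realType) (N : set R) (t : R) :
  Lebesgue_null N -> Lebesgue_null ((fun x : R => x + t) @^-1` N).
Proof.
move=> [A [mA A0 NA]].
have mt : measurable_fun [set: R] (fun x : R => x + t).
  exact: measurable_realfun.measurable_funD.
exists ((fun x => x + t) @^-1` A); split; last exact: preimage_subset.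
  by rewrite -[X in measurable X]setTI; exact: mt.
by rewrite -A0 -(lebesgue_measure_shift t mA).
Qed.

Lemma lebesgue_null_bigcup (R : realType) (I : countType) (F : I -> set R) :
  (forall i, Lebesgue_null (F i)) -> Lebesgue_null (\bigcup_i F i).
Proof.
move=> F0.
pose G (k : nat) : set R := if choice.unpickle k is Some i then F i else set0.
have G0 : Lebesgue_null (\bigcup_k G k).
  apply: negligible_bigcup => k; rewrite /G.
  by case: choice.unpickle => [i|]; [exact: F0|exact: negligible_set0].
apply: negligibleS G0 => x [i _ Fx].
by exists (choice.pickle i) => //; rewrite /G choice.pickleK.
Qed.

Lemma lebesgue_null_neqT (R : realType) (N : set R) :
  Lebesgue_null N -> exists x, ~ N x.
Proof.
move=> N0; apply: contrapT => /forallNP NT.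
have T0 : Lebesgue_null [set: R].
  by apply: negligibleS N0 => x _; apply: contrapT; exact: NT.
have : lebesgue_measure [set: R] = 0%E by apply/negligibleP.
by rewrite -set_itvNyy lebesgue_measure_itv.
Qed.

(** * From the line to its integer fibres *)

Lemma translateE (R : realType) (E : set R) (t x : R) :
  translate E t x = E (x - t).
Proof.
apply/propext; split=> [[y Ey <-]|Ex]; first by rewrite addrK.
by exists (x - t) => //; rewrite subrK.
Qed.

(** The exceptional set [N] collects all integer translates of the set [N0] of
    points covered by no tile or by two, so that off [N] the tiling is exact at
    every [x + n] simultaneously. *)
Lemma tiles_fibre (R : realType) (E : set R) (B : {fset int}) :
  tiles E (int_points R B) ->
  exists2 N : set R, Lebesgue_null N &
    forall x, ~ N x -> tiles_int (fun n => `[< E (x + n%:~R) >]) B.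
Proof.
move=> [EI EU].
pose T (b : int) := translate E b%:~R.
pose O (bc : int * int) :=
  [set x | [/\ bc.1 \in B, bc.2 \in B, bc.1 != bc.2, T bc.1 x & T bc.2 x]].
pose U := [set x | forall b, b \in B -> ~ T b x].
pose N0 := U `|` \bigcup_bc O bc.
have N00 : Lebesgue_null N0.
  apply: negligibleU.
    apply: negligibleS EU => x Ux; right; split=> // -[_ [b /= bB <-]].
    exact: Ux.
  apply: lebesgue_null_bigcup => -[b c]; rewrite /O/=.
  have [bcB|bcB] := pselect [/\ b \in B, c \in B & b != c]; last first.
    apply: negligibleS (@negligible_set0 _ _ _ _) => x [? ? ? _ _].
    by case: bcB.
  case: bcB => bB cB bc.
  apply: negligibleS (EI b%:~R c%:~R _ _ _); first by move=> x [].
  - by exists b.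
  - by exists c.
  - by move=> /intr_inj /eqP; exact/negP.
exists (\bigcup_(n : int) (fun x => x + n%:~R) @^-1` N0).
  by apply: lebesgue_null_bigcup => n; exact: lebesgue_null_preimage_shift.
move=> x Nx n.
have {}Nx : ~ N0 (x + n%:~R) by move=> xN; apply: Nx; exists n.
have ET b : `[< E (x + (n - b)%:~R) >] <-> T b (x + n%:~R).
  rewrite /T translateE intrB addrA.
  by split=> /asboolP.
have [b [bB Tb]] : exists b, b \in B /\ T b (x + n%:~R).
  apply: contrapT => /forallNP bN; apply: Nx; left => b bB Tb.
  exact: (bN b).
exists b; split; first by split=> //; exact/ET.
move=> c [cB /ET Tc]; apply/eqP; case: (boolP (b == c)) => // bc.
by case: Nx; right; exists (b, c).
Qed.

Theorem theorem4p3 (R : realType) (Omega : set R) (B : {fset int}) (p : nat)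
    (mOmega : Lebesgue_measurable Omega)
    (tOmega : tiles Omega (int_points R B))
    (cardB : #|` B| = p) (p_prime : prime p)
    (B0 : 0 \in B) (gcdB : gcd_fset B = 1) :
  complete_representatives B p /\ has_period Omega p%:R.
Proof.
have [N N0 fibre] := tiles_fibre tOmega.
have fibre_per x : ~ N x -> forall n : int,
    `[< Omega (x + (n + p%:Z)%:~R) >] = `[< Omega (x + n%:~R) >].
  by move=> /fibre; exact: tiles_int_periodic.
split.
  have [x Nx] := lebesgue_null_neqT N0.
  exact: tiles_int_complete (prime_gt0 p_prime) cardB (fibre x Nx)
    (fibre_per x Nx).
apply: negligibleS N0 => x px; apply: contrapT => Nx.
have := fibre_per x Nx (- p%:Z); rewrite addNr mulr0z addr0 mulrNz -pmulrn.
move=> pE; have {}pE := asbool_eq_equiv pE.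
by case: px => -[]; rewrite translateE => /pE Ox; apply.
Qed.
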